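(* Let $Sp(K,S)$ be a split graph with biadjacency matrix $R$, and let $G$ be a graph (disjoint from $Sp$). Then \[\mathcal{N}(Sp\circ G)\supseteq\{(0,z,0)^t: z\in\mathcal{N}(R)\},\] where vectors indexed by $V(Sp\circ G)$ are written in blocks according to the ordering $(K,S,V(G))$. In particular, if $\mathcal{N}(R)\ne\{0\}$, then $Sp\circ G$ is singular.
   Context: Graphs are finite and simple. A split graph is a graph $Sp$ whose vertex set is a disjoint union of a clique $K$ and an independent set $S$; the pair $(K,S)$ is called an s-partition, and $Sp(K,S)$ denotes $Sp$ together with this s-partition. Both $K$ and $S$ are assumed nonempty. $R$ is the $|K|\times|S|$ $0/1$ biadjacency matrix ($R_{uv}=1$ iff $u\in K$ and $v\in S$ are adjacent). $\mathcal{N}$ denotes the nullspace of a real matrix, and for a graph the nullspace of its adjacency matrix; a graph is singular if its adjacency matrix is singular. For a split graph $Sp(K,S)$ and a graph $G$ disjoint from it, the Tyshkevich composition $Sp\circ G$ is the graph with vertex set $V(Sp)\cup V(G)$ and edge set $E(Sp)\cup E(G)\cup\{xy: x\in K,\ y\in V(G)\}$. *)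

(* Defs.v *)
From HB Require Import structures.
From mathcomp Require Import all_boot all_order all_algebra.
From mathcomp Require Import reals.

Set Implicit Arguments.
Unset Strict Implicit.
Unset Printing Implicit Defensive.

Import GRing.Theory.
Local Open Scope ring_scope.

Record sgraph := SGraph {
  vertex :> finType;
  edge : rel vertex;
  edge_sym : symmetric edge;
  edge_irr : irreflexive edge }.

Notation "x -- y" := (edge x y) (at level 30).

Definition clique (G : sgraph) (K : {set G}) : Prop :=
  {in K &, forall x y, x != y -> x -- y}.

Definition independent (G : sgraph) (S : {set G}) : Prop :=
  {in S &, forall x y, ~~ (x -- y)}.

Definition s_partition (Sp : sgraph) (K S : {set Sp}) : Prop :=
  [/\ K != set0 /\ S != set0, K :|: S = [set: Sp], [disjoint K & S],
      clique K & independent S].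

(* The disjointness of V(Sp) and V(G) is provided by the sum type.  The *)
(* independent part S of the s-partition plays no role in the construction. *)
Definition comp_edge (Sp : sgraph) (K : {set Sp}) (G : sgraph) :
    rel (Sp + G)%type :=
  fun u v => match u, v with
  | inl x, inl y => x -- y
  | inr x, inr y => x -- y
  | inl x, inr _ => x \in K
  | inr _, inl y => y \in K
  end.

Lemma comp_edge_sym (Sp : sgraph) (K : {set Sp}) (G : sgraph) :
  symmetric (@comp_edge Sp K G).
Proof. by move=> [x|x] [y|y] //=; apply: edge_sym. Qed.

Lemma comp_edge_irr (Sp : sgraph) (K : {set Sp}) (G : sgraph) :
  irreflexive (@comp_edge Sp K G).
Proof. by move=> [x|x] /=; apply: edge_irr. Qed.

Definition tyshkevich (Sp : sgraph) (K : {set Sp}) (G : sgraph) : sgraph :=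
  SGraph (@comp_edge_sym Sp K G) (@comp_edge_irr Sp K G).

Definition biadjmx (F : realType) (Sp : sgraph) (K S : {set Sp}) :
    'M[F]_(#|K|, #|S|) :=
  \matrix_(i, j) (enum_val i -- enum_val j)%:R.

(* Adjacency matrix with respect to an ordering f of the vertices, which is *)
(* meant to be a bijection from 'I_n onto G. *)
Definition adjmx (F : realType) (G : sgraph) (n : nat) (f : 'I_n -> G) :
    'M[F]_n :=
  \matrix_(i, j) (f i -- f j)%:R.

Definition nullspace (F : realType) (m n : nat) (A : 'M[F]_(m, n)) :
    {vspace 'cV[F]_n} :=
  lker (linfun (mulmx A)).

(* Singularity does not depend on the ordering; the one of enum G is used. *)
Definition singular (F : realType) (G : sgraph) : Prop :=
  adjmx F (fun i : 'I_#|G| => enum_val i) \notin unitmx.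

(* The ordering (K, S, V(G)) of the vertices of the composition. *)
Definition block_order (Sp : sgraph) (K S : {set Sp}) (G : sgraph)
    (i : 'I_(#|K| + #|S| + #|G|)) : tyshkevich K G :=
  match split i with
  | inl j => match split j with
             | inl k => inl (enum_val k)
             | inr s => inl (enum_val s)
             end
  | inr g => inr (enum_val g)
  end.

Lemma block_order_bij (Sp : sgraph) (K S : {set Sp}) (G : sgraph) :
  s_partition K S -> bijective (@block_order Sp K S G).
Proof.
move=> [_ KS dKS _ _].
have nKS x : x \in K -> x \in S -> False.
  by move=> xK xS; have := disjointFr dKS xK; rewrite xS.
apply: inj_card_bij; last first.
  have -> : #|tyshkevich K G| = (#|Sp| + #|G|)%N by exact: card_sum.
  by rewrite card_ord -[#|Sp|]cardsT -KS cardsU (disjoint_setI0 dKS) cards0 subn0.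
move=> i j; rewrite /block_order => e.
apply: (can_inj (@splitK _ _)).
case: (split i) (split j) e => [a|a] [b|b].
- move=> e; suff -> : a = b by [].
  apply: (can_inj (@splitK _ _)).
  case: (split a) (split b) e => [c|c] [d|d] [] e.
  + by rewrite (enum_val_inj e).
  + by case: (nKS (enum_val c)); [exact: enum_valP | rewrite e; exact: enum_valP].
  + by case: (nKS (enum_val d)); [exact: enum_valP | rewrite -e; exact: enum_valP].
  + by rewrite (enum_val_inj e).
- by case: (split a).
- by case: (split b).
- by case=> /enum_val_inj ->.
Qed.

Definition block_vec (F : realType) (k s g : nat)
    (x : 'cV[F]_k) (z : 'cV[F]_s) (y : 'cV[F]_g) : 'cV[F]_(k + s + g) :=
  col_mx (col_mx x z) y.

(* Main.v *)
Require Import Defs.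
From mathcomp Require Import all_boot all_order all_algebra.
From mathcomp Require Import reals.
Local Open Scope ring_scope.

(** Row by row: a row of the adjacency matrix applied to (0,z,0) only sees the
    columns in S.  There, rows in K form R, rows in S vanish since S is
    independent, and rows in V(G) vanish since G is joined to K only. *)

Import GRing.Theory.

Lemma mem_nullspace (F : realType) (m n : nat) (A : 'M[F]_(m, n)) (z : 'cV[F]_n) :
  (z \in nullspace A) = (A *m z == 0).
Proof. by rewrite memv_ker lfunE. Qed.

(** Bridges an arbitrary vertex ordering [f] and the ordering by [enum_val] fixed in [singular]:
    permuting the coordinates of a kernel vector accordingly gives a nonzero kernel vector of the
    other matrix. *)
Lemma adjmx_ker_singular (F : realType) (G : sgraph) (n : nat) (f : 'I_n -> G)
    (w : 'cV[F]_n) :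
  bijective f -> w \in nullspace (adjmx F f) -> w != 0 -> singular F G.
Proof.
move=> [g fK gK]; rewrite mem_nullspace => /eqP Aw0; apply: contraNN => unitA.
pose w' : 'cV[F]_#|G| := \col_i w (g (enum_val i)) 0.
have Aw'0 : adjmx F (fun i : 'I_#|G| => enum_val i) *m w' = 0.
  apply/colP => i; rewrite !mxE.
  have := congr1 (fun v : 'cV[F]_n => v (g (enum_val i)) 0) Aw0.
  rewrite !mxE; apply: etrans.
  (* Position [k] under [f] becomes position [enum_rank (f k)]; the inverse sends [j] to
     [g (enum_val j)]. *)
  rewrite (reindex (fun k => enum_rank (f k))) /=; last first.
    exists (fun j => g (enum_val j)) => j _; first by rewrite enum_rankK fK.
    by rewrite gK enum_valK.
  by apply: eq_bigr => k _; rewrite !mxE enum_rankK fK gK.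
have w'0 : w' = 0 by rewrite -(mulKmx unitA w') Aw'0 mulmx0.
apply/eqP/colP => k.
have := congr1 (fun v : 'cV[F]_#|G| => v (enum_rank (f k)) 0) w'0.
by rewrite !mxE enum_rankK fK.
Qed.

Lemma adjmx_block_vec (F : realType) (Sp : sgraph) (K S : {set Sp}) (G : sgraph)
    (z : 'cV[F]_#|S|) i :
  (adjmx F (@block_order Sp K S G) *m block_vec 0 z 0) i 0 =
  \sum_s (edge (block_order i) (inl (enum_val s) : tyshkevich K G))%:R * z s 0.
Proof.
rewrite mxE big_split_ord /= big_split_ord /= big1 ?add0r; last first.
  by move=> k _; rewrite /block_vec !col_mxEu [X in _ * X]mxE mulr0.
rewrite [X in _ + X]big1 ?addr0; last first.
  by move=> k _; rewrite /block_vec col_mxEd [X in _ * X]mxE mulr0.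
apply: eq_bigr => s _; rewrite /block_vec col_mxEu col_mxEd mxE.
(* Only the column's vertex is computed; the row [i] stays generic, for a later case split on its
   block. *)
by rewrite {2}/block_order (unsplitK (inl _)) (unsplitK (inr _)).
Qed.

Lemma block_vec_nullspace (F : realType) (Sp : sgraph) (K S : {set Sp})
    (G : sgraph) (z : 'cV[F]_#|S|) :
  s_partition K S -> z \in nullspace (biadjmx F K S) ->
  block_vec (0 : 'cV[F]_#|K|) z (0 : 'cV[F]_#|G|)
    \in nullspace (adjmx F (@block_order Sp K S G)).
Proof.
move=> [_ _ dKS _ indepS]; rewrite !mem_nullspace => /eqP Rz0.
apply/eqP/colP => i; rewrite adjmx_block_vec mxE /block_order.
case: (split i) => [j|g]; last first.
  (* Here adjacency has reduced to [enum_val s \in K], which fails because [K] and [S] are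
     disjoint. *)
  by rewrite big1 // => s _ /=; rewrite (disjointFl dKS (enum_valP s)) mul0r.
case: (split j) => [k|t] /=.
  have := congr1 (fun v : 'cV[F]_#|K| => v k 0) Rz0.
  by rewrite !mxE; apply: etrans; apply: eq_bigr => s _; rewrite mxE.
rewrite big1 // => s _.
by rewrite (negbTE (indepS _ _ (enum_valP t) (enum_valP s))) mul0r.
Qed.

Theorem theorem7p1 (F : realType) (Sp : sgraph) (K S : {set Sp}) (G : sgraph)
    (hSp : s_partition K S) :
  (forall z : 'cV[F]_#|S|,
      z \in nullspace (biadjmx F K S) ->
      block_vec (0 : 'cV[F]_#|K|) z (0 : 'cV[F]_#|G|)
        \in nullspace (adjmx F (@block_order Sp K S G))) /\
  (nullspace (biadjmx F K S) != 0%VS -> singular F (tyshkevich K G)).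
Proof.
have kerR z := @block_vec_nullspace F Sp K S G z hSp.
split=> // R_ker; have zR := memv_pick (nullspace (biadjmx F K S)).
apply: adjmx_ker_singular (block_order_bij G hSp) (kerR _ zR) _.
(* The block vector vanishes only if its middle block does, and [vpick] of a nonzero space is
   nonzero. *)
by rewrite !col_mx_eq0 !eqxx andbT vpick0.
Qed.
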